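(* Let $A\in\mathbb{R}^{n\times m}$ be a nonzero matrix with positive singular values $s_1\ge\dots\ge s_r>0$ ($r=\mathrm{rank}\,A$) and let $\mathbf{g}^\eta\in\mathbb{R}^n$, $\mathbf{g}^\eta\ne0$. For any $\alpha_0\in[0,s_1^2/2]$, the sequence $\{\alpha_k\}_{k\ge0}$ generated by the I-PRO iteration $$\alpha_{k+1}=\arg\min_{\alpha\in[0,s_1^2/2]}\left\{\rho^2(\alpha_k)\frac{\alpha^2}{(\alpha+s_1^2)^2}+\sigma^2(\alpha_k)\sum_{i=1}^r\frac{s_i^4}{(\alpha+s_i^2)^2}\right\},\qquad k\ge0,$$ is monotone (i.e., either nondecreasing or nonincreasing).
   Context: $A^*$ denotes the transpose of $A$ and $\|\cdot\|$ the Euclidean norm. For $\alpha>0$, $\mathbf{f}_\alpha^\eta=(A^*A+\alpha I)^{-1}A^*\mathbf{g}^\eta$ is the Tikhonov solution, and for $\alpha=0$ it is its limit as $\alpha\to0^+$, i.e. the minimum-norm least-squares solution. The noise variance estimate and the squared data norm estimate, as functions of $\alpha\ge0$, are $$\sigma^2(\alpha)=\frac1n\|A\mathbf{f}_\alpha^\eta-\mathbf{g}^\eta\|^2,\qquad \rho^2(\alpha)=\|\mathbf{g}^\eta\|^2-\|A\mathbf{f}_\alpha^\eta-\mathbf{g}^\eta\|^2.$$ The I-PRO algorithm alternates between computing $\sigma^2(\alpha_k),\rho^2(\alpha_k)$ and minimizing the displayed function to obtain $\alpha_{k+1}$; the sequence is considered without the stopping test. Since $\mathbf{g}^\eta\neq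 0$, the two coefficients are nonnegative and not both zero, and the minimizer is unique. *)

(* Defs.v *)
From HB Require Import structures.
From mathcomp Require Import all_boot all_order all_algebra.
From mathcomp Require Import all_classical all_reals all_analysis.

Set Implicit Arguments.
Unset Strict Implicit.
Unset Printing Implicit Defensive.

Import numFieldNormedType.Exports.
Import Order.TTheory GRing.Theory Num.Theory.

Local Open Scope classical_set_scope.
Local Open Scope ring_scope.

(* The library norm `|v| on matrices is the sup norm, hence this definition. *)
Definition euclid_norm (R : realType) (n : nat) (v : 'cV[R]_n) : R :=
  Num.sqrt (\sum_(i < n) v i 0 ^+ 2).

(* The positive singular values of A are the square roots of the nonzero
   eigenvalues of A^T A, listed in nonincreasing order with multiplicity.
   The multiplicity is the one in the characteristic polynomial, which for the
   symmetric matrix A^T A is also the dimension of the eigenspace. *)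
Definition positive_singular_values (R : realType) (n m : nat)
    (A : 'M[R]_(n, m)) (s : (\rank A).-tuple R) : Prop :=
  [/\ sorted >=%R s,
      forall i : 'I_(\rank A), 0 < tnth s i
    & char_poly (A^T *m A) =
        'X^(m - \rank A) *
        \prod_(i < \rank A) ('X - (tnth s i ^+ 2)%:P)].
Arguments positive_singular_values {R n m} A s.

Definition tikhonov_reg (R : realType) (n m : nat) (A : 'M[R]_(n, m))
    (g : 'cV[R]_n) (a : R) : 'cV[R]_m :=
  invmx (A^T *m A + a%:M) *m (A^T *m g).

(* Only used for 0 <= a. The topology on 'cV[R]_m is the usual one, and the
   limit at 0 exists: it is the least-squares solution of minimum norm. *)
Definition tikhonov (R : realType) (n m : nat) (A : 'M[R]_(n, m))
    (g : 'cV[R]_n) (a : R) : 'cV[R]_m :=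
  if a == 0 then lim (tikhonov_reg A g x @[x --> 0^'+])
  else tikhonov_reg A g a.

Definition sigma2 (R : realType) (n m : nat) (A : 'M[R]_(n, m))
    (g : 'cV[R]_n) (a : R) : R :=
  n%:R^-1 * euclid_norm (A *m tikhonov A g a - g) ^+ 2.

Definition rho2 (R : realType) (n m : nat) (A : 'M[R]_(n, m))
    (g : 'cV[R]_n) (a : R) : R :=
  euclid_norm g ^+ 2 - euclid_norm (A *m tikhonov A g a - g) ^+ 2.

(* s`_0 is the largest singular value s_1. *)
Definition ipro_objective (R : realType) (n m : nat) (A : 'M[R]_(n, m))
    (g : 'cV[R]_n) (s : (\rank A).-tuple R) (ak a : R) : R :=
  rho2 A g ak * (a ^+ 2 / (a + s`_0 ^+ 2) ^+ 2) +
  sigma2 A g ak *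
    \sum_(i < \rank A) (tnth s i ^+ 4 / (a + tnth s i ^+ 2) ^+ 2).
Arguments ipro_objective {R n m} A g s ak a.

Definition is_argmin (R : realType) (D : set R) (f : R -> R) (x : R) : Prop :=
  D x /\ forall y, D y -> f x <= f y.

Definition ipro_sequence (R : realType) (n m : nat) (A : 'M[R]_(n, m))
    (g : 'cV[R]_n) (s : (\rank A).-tuple R) (alpha : nat -> R) : Prop :=
  alpha 0%N \in `[0, s`_0 ^+ 2 / 2] /\
  forall k : nat,
    is_argmin `[0, s`_0 ^+ 2 / 2]%classic
      (ipro_objective A g s (alpha k)) (alpha k.+1).
Arguments ipro_sequence {R n m} A g s alpha.

(* Main.v *)
Require Import Defs.
From HB Require Import structures.
From mathcomp Require Import all_boot all_order all_algebra.
From mathcomp Require Import all_classical all_reals all_analysis.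
From mathcomp Require Import ring lra.

Set Implicit Arguments.
Unset Strict Implicit.
Unset Printing Implicit Defensive.

Import numFieldNormedType.Exports.
Import Order.TTheory GRing.Theory Num.Theory.

Local Open Scope classical_set_scope.
Local Open Scope ring_scope.

(* The residual T(a) = |A f_a - g|^2 is nondecreasing in a >= 0 and lies in
   [0, |g|^2]. This needs no singular vectors: it follows from the equation
   A^T (A f_a - g) = - a f_a, which also holds at a = 0. So when a increases,
   sigma^2 weakly increases and rho^2 weakly decreases. In the objective,
   sigma^2 multiplies a strictly decreasing function and rho^2 an increasing
   one, hence the minimizer weakly increases: alpha_{k+1} is a nondecreasing
   function of alpha_k, and the first step fixes the direction of the whole
   sequence. When both weights are unchanged one also needs the minimizer to be
   unique; this comes from convexity on [0, s_1^2/2]. *)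

(** * Inner product and Euclidean norm of column vectors *)

Definition dotv (R : realType) (n : nat) (u v : 'cV[R]_n) : R :=
  (u^T *m v) 0 0.

Lemma dotvE (R : realType) (n : nat) (u v : 'cV[R]_n) :
  dotv u v = \sum_(i < n) u i 0 * v i 0.
Proof. by rewrite /dotv mxE; apply: eq_bigr => i _; rewrite mxE. Qed.

Lemma dotvC (R : realType) (n : nat) (u v : 'cV[R]_n) : dotv u v = dotv v u.
Proof. by rewrite !dotvE; apply: eq_bigr => i _; rewrite mulrC. Qed.

Lemma dotvDr (R : realType) (n : nat) (u v w : 'cV[R]_n) :
  dotv u (v + w) = dotv u v + dotv u w.
Proof. by rewrite /dotv mulmxDr mxE. Qed.

Lemma dotvZr (R : realType) (n : nat) (a : R) (u v : 'cV[R]_n) :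
  dotv u (a *: v) = a * dotv u v.
Proof. by rewrite /dotv -scalemxAr mxE. Qed.

Lemma dotvNr (R : realType) (n : nat) (u v : 'cV[R]_n) :
  dotv u (- v) = - dotv u v.
Proof. by rewrite -scaleN1r dotvZr mulN1r. Qed.

Lemma dotv_sqrD (R : realType) (n : nat) (u v : 'cV[R]_n) :
  dotv (u + v) (u + v) = dotv u u + 2 * dotv u v + dotv v v.
Proof. by rewrite dotvDr !(dotvC (u + v)) !dotvDr (dotvC v u); ring. Qed.

Lemma dotv_adj (R : realType) (n m : nat) (A : 'M[R]_(n, m))
    (u : 'cV[R]_m) (v : 'cV[R]_n) :
  dotv (A *m u) v = dotv u (A^T *m v).
Proof. by rewrite /dotv trmx_mul mulmxA. Qed.

Lemma dotv_ge0 (R : realType) (n : nat) (u : 'cV[R]_n) : 0 <= dotv u u.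
Proof. by rewrite dotvE sumr_ge0 // => i _; rewrite -expr2 sqr_ge0. Qed.

Lemma sqr_entry_le_dotv (R : realType) (n : nat) (u : 'cV[R]_n) (i : 'I_n) :
  u i 0 ^+ 2 <= dotv u u.
Proof.
rewrite dotvE (bigD1 i) //= -expr2 lerDl sumr_ge0 // => j _.
by rewrite -expr2 sqr_ge0.
Qed.

Lemma dotv_le0 (R : realType) (n : nat) (u : 'cV[R]_n) :
  dotv u u <= 0 -> u = 0.
Proof.
move=> u0; apply/colP => i; rewrite mxE; apply/eqP; rewrite -sqrf_eq0.
by rewrite eq_le sqr_ge0 (le_trans (sqr_entry_le_dotv u i) u0).
Qed.

Lemma euclid_norm_sqr (R : realType) (n : nat) (u : 'cV[R]_n) :
  euclid_norm u ^+ 2 = dotv u u.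
Proof.
rewrite /euclid_norm sqr_sqrtr ?dotvE; last first.
  by apply: sumr_ge0 => i _; rewrite sqr_ge0.
by apply: eq_bigr => i _; rewrite expr2.
Qed.

(** * Gram matrices and Tikhonov solutions *)

Lemma submx_gram (R : realType) (n m : nat) (M : 'M[R]_(n, m)) :
  (M <= M^T *m M)%MS.
Proof.
rewrite submxE; have := mulmx_coker (M^T *m M); move: (cokermx _) => C MMC.
apply/eqP/matrixP => i j; rewrite [RHS]mxE.
have -> : (M *m C) i j = (M *m col j C) i 0.
  by rewrite colE mulmxA -colE [RHS]mxE.
(* For a column c of [C], |M c|^2 is the inner product of c with M^T M c = 0. *)
suff -> : M *m col j C = 0 by rewrite mxE.
apply: dotv_le0; rewrite dotv_adj colE !mulmxA MMC mul0mx.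
by rewrite /dotv mulmx0 mxE.
Qed.

(* A, A^T A and (A^T A)^2 have the same row space. Membership in the range of
   the square makes the Tikhonov error at a of size O(a). *)
Lemma normal_eq_range (R : realType) (n m : nat) (A : 'M[R]_(n, m))
    (g : 'cV[R]_n) :
  exists z : 'cV[R]_m, A^T *m g = A^T *m A *m (A^T *m A *m z).
Proof.
pose B := A^T *m A.
have trB : B^T = B by rewrite /B trmx_mul trmxK.
have AB : (A <= B *m B)%MS.
  by apply: (submx_trans (submx_gram A)); have := submx_gram B; rewrite trB.
have /submxP[D gD] : (g^T *m A <= B *m B)%MS := submx_trans (submxMl _ _) AB.
exists D^T; apply: trmx_inj.
by rewrite trmx_mul trmxK gD -/B (trmx_mul B) (trmx_mul B) trmxK trB mulmxA.
Qed.

(** Pairing the equation of a kernel vector x with x gives |A x|^2 + a |x|^2 = 0, which forces x =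
    0. *)
Lemma gram_shift_unit (R : realType) (n m : nat) (A : 'M[R]_(n, m)) (a : R) :
  0 < a -> A^T *m A + a%:M \in unitmx.
Proof.
move=> a0; rewrite -row_free_unit -kermx_eq0; apply/eqP/row_matrixP => i.
rewrite row0; set x := row i _.
have : x *m (A^T *m A + a%:M) = 0 by rewrite -row_mul mulmx_ker row0.
move=> /(congr1 trmx); rewrite trmx0 trmx_mul linearD /= trmx_mul trmxK.
rewrite tr_scalar_mx mulmxDl mul_scalar_mx => /(congr1 (dotv x^T)).
rewrite dotvDr dotvZr -mulmxA -dotv_adj {3}/dotv mulmx0 mxE => E.
apply: trmx_inj; rewrite trmx0; apply: dotv_le0.
have := dotv_ge0 (A *m x^T); nra.
Qed.

(* With y = a z - e one has A^T A y = a e, so e and y make an acute angle. *)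
Lemma gram_shift_le (R : realType) (n m : nat) (A : 'M[R]_(n, m)) (a : R)
    (e z : 'cV[R]_m) : 0 < a ->
  A^T *m A *m e + a *: e = a *: (A^T *m A *m z) ->
  dotv e e <= a ^+ 2 * dotv z z.
Proof.
move=> a0 E; pose y := a *: z - e.
have By : A^T *m (A *m y) = a *: e.
  by rewrite mulmxA mulmxBr -scalemxAr -E addrC addKr.
have ey : 0 <= a * dotv e y.
  by rewrite dotvC -dotvZr -By -dotv_adj dotv_ge0.
have -> : a ^+ 2 * dotv z z = dotv (e + y) (e + y).
  by rewrite /y addrC subrK dotvZr dotvC dotvZr mulrA.
by rewrite dotv_sqrD; have := dotv_ge0 y; nra.
Qed.

(** Passes from Euclidean bounds to the sup norm, in which convergence of matrices is expressed. *)
Lemma mx_norm_le_dotv (R : realType) (m : nat) (u : 'cV[R]_m) (c : R) :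
  0 <= c -> dotv u u <= c ^+ 2 -> `|u| <= c.
Proof.
move=> c0 uc; rewrite [leLHS]/Num.Def.normr /= mx_normrE.
rewrite bigmax_le // => -[i j] _ /=.
by rewrite (ord1 j) -ler_sqr ?nnegrE // real_normK ?num_real //
  (le_trans (sqr_entry_le_dotv u i)).
Qed.

Lemma tikhonov_reg_eq (R : realType) (n m : nat) (A : 'M[R]_(n, m))
    (g : 'cV[R]_n) (a : R) : 0 < a ->
  A^T *m A *m tikhonov_reg A g a + a *: tikhonov_reg A g a = A^T *m g.
Proof.
move=> a0; rewrite -mul_scalar_mx -mulmxDl /tikhonov_reg.
by rewrite mulKVmx // gram_shift_unit.
Qed.

Lemma tikhonov_reg_cvg (R : realType) (n m : nat) (A : 'M[R]_(n, m))
    (g : 'cV[R]_n) (z : 'cV[R]_m) :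
  A^T *m g = A^T *m A *m (A^T *m A *m z) ->
  tikhonov_reg A g x @[x --> 0^'+] --> A^T *m A *m z.
Proof.
move=> gz; set h := A^T *m A *m z; apply/cvgrPdist_le => e e0.
(* Adding 1 keeps [c] positive even when [z] is zero, so [e / c] is a valid radius. *)
pose c := Num.sqrt (dotv z z) + 1.
have c0 : 0 < c by rewrite ltr_wpDl ?sqrtr_ge0.
near=> a.
have a0 : 0 < a by near: a; exact: nbhs_right_gt.
have ae : a * c <= e.
  by rewrite -ler_pdivlMr //; near: a; apply: nbhs_right_le; rewrite divr_gt0.
apply: le_trans ae; apply: mx_norm_le_dotv; first by rewrite mulr_ge0 ?ltW.
(* The error solves the shifted equation with right-hand side [a *: h], so [gram_shift_le] bounds it
   by a |z|. *)
have E : A^T *m A *m (h - tikhonov_reg A g a) +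
    a *: (h - tikhonov_reg A g a) = a *: h.
  rewrite mulmxBr scalerBr addrACA -opprD tikhonov_reg_eq // gz -/h.
  by rewrite addrAC subrr add0r.
apply: (le_trans (gram_shift_le a0 E)); rewrite exprMn ler_wpM2l ?sqr_ge0 //.
rewrite -[leLHS](sqr_sqrtr (dotv_ge0 z)) /c.
by have := sqrtr_ge0 (dotv z z); nra.
Unshelve. all: by end_near. Qed.

(** At [a = 0] the limit is [A^T *m A *m z], an exact solution of the normal equation, so both sides
    vanish. *)
Lemma tikhonov_normal_eq (R : realType) (n m : nat) (A : 'M[R]_(n, m))
    (g : 'cV[R]_n) (a : R) : 0 <= a ->
  A^T *m (A *m tikhonov A g a - g) = - (a *: tikhonov A g a).
Proof.
rewrite le_eqVlt mulmxBr mulmxA /tikhonov => /orP[/eqP <-|a0].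
  have [z gz] := normal_eq_range A g.
  rewrite eqxx (cvg_lim (@norm_hausdorff _ _) (tikhonov_reg_cvg gz)).
  by rewrite -gz subrr scale0r oppr0.
by rewrite gt_eqF // -(tikhonov_reg_eq A g a0) opprD addrA subrr add0r.
Qed.

(** * The residual as a function of the regularization parameter *)

Definition residual2 (R : realType) (n m : nat) (A : 'M[R]_(n, m))
    (g : 'cV[R]_n) (a : R) : R :=
  euclid_norm (A *m tikhonov A g a - g) ^+ 2.

Lemma residual2_ge0 (R : realType) (n m : nat) (A : 'M[R]_(n, m))
    (g : 'cV[R]_n) (a : R) : 0 <= residual2 A g a.
Proof. exact: sqr_ge0. Qed.

Lemma residual2_le (R : realType) (n m : nat) (A : 'M[R]_(n, m))
    (g : 'cV[R]_n) (a : R) : 0 <= a ->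
  residual2 A g a <= euclid_norm g ^+ 2.
Proof.
move=> a0; rewrite /residual2 !euclid_norm_sqr.
have := tikhonov_normal_eq A g a0; set f := tikhonov _ _ _ => E.
set r := A *m f - g in E *.
(* The inner product of [r] and A f is nonpositive, so subtracting A f from [r], which gives -g,
   cannot shorten it. *)
have fr : dotv r (A *m f) = - (a * dotv f f).
  by rewrite dotvC dotv_adj E dotvNr dotvZr.
have -> : dotv g g = dotv (r + - (A *m f)) (r + - (A *m f)).
  by rewrite /r addrAC subrr add0r dotvNr dotvC dotvNr opprK.
rewrite [leRHS]dotv_sqrD (dotvNr r) fr; have := dotv_ge0 (- (A *m f)).
have := mulr_ge0 a0 (dotv_ge0 f); lra.
Qed.

Lemma residual2_nondecreasing (R : realType) (n m : nat) (A : 'M[R]_(n, m))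
    (g : 'cV[R]_n) (a b : R) : 0 <= a -> a <= b ->
  residual2 A g a <= residual2 A g b.
Proof.
move=> a0; rewrite le_eqVlt => /orP[/eqP -> //|ab].
have b0 : 0 <= b by exact: le_trans (ltW ab).
rewrite /residual2 !euclid_norm_sqr.
have := tikhonov_normal_eq A g a0; have := tikhonov_normal_eq A g b0.
set u := tikhonov A g a; set w := tikhonov A g b => Ew Eu.
pose d := w - u.
have Ed : A^T *m (A *m d) = (a - b) *: u - b *: d.
  have -> : A *m d = (A *m w - g) - (A *m u - g).
    by rewrite /d mulmxBr opprB addrA subrK.
  rewrite mulmxBr Ew Eu /d scalerBr scalerBl opprB opprK addrC addrA.
  by rewrite subrK.
have Edd : dotv (A *m d) (A *m d) = (a - b) * dotv d u - b * dotv d d.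
  by rewrite dotv_adj Ed dotvDr dotvNr !dotvZr.
(* By [Edd], (a - b) d.u = |A d|^2 + b |d|^2 >= 0 with a < b. The cross term of the final expansion,
   -2 a d.u, is then nonnegative. *)
have du : dotv d u <= 0.
  have := dotv_ge0 (A *m d); have := mulr_ge0 b0 (dotv_ge0 d); nra.
have -> : A *m w - g = (A *m u - g) + A *m d.
  by rewrite /d mulmxBr [RHS]addrC addrA subrK.
rewrite [leRHS]dotv_sqrD (dotvC _ (A *m d)) dotv_adj Eu dotvNr dotvZr.
have := dotv_ge0 (A *m d); have := mulr_ge0_le0 a0 du; lra.
Qed.

(** * Convexity estimates and comparison of minimizers *)

Lemma sqrV_midpoint (R : realType) (x y : R) : 0 < x -> 0 < y -> x != y ->
  ((x + y) / 2) ^- 2 < (x ^- 2 + y ^- 2) / 2.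
Proof.
move=> x0 y0 xy.
rewrite -subr_gt0.
have -> : (x ^- 2 + y ^- 2) / 2 - ((x + y) / 2) ^- 2 =
    (x - y) ^+ 2 * (x ^+ 2 + 4 * x * y + y ^+ 2) /
    (2 * x ^+ 2 * y ^+ 2 * (x + y) ^+ 2).
  by field; rewrite !gt_eqF // addr_gt0.
have xy0 : 0 < (x - y) ^+ 2 by rewrite exprn_even_gt0 //= subr_eq0.
apply: divr_gt0; last by rewrite !(mulr_gt0, exprn_gt0) // addr_gt0.
by rewrite mulr_gt0 // !(addr_gt0, exprn_gt0) // !mulr_gt0.
Qed.

(* The restriction to [0, t / 2] is where this function is convex. *)
Lemma sqr_ratio_midpoint (R : realType) (t x y : R) : 0 < t ->
  0 <= x -> x <= t / 2 -> 0 <= y -> y <= t / 2 ->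
  ((x + y) / 2) ^+ 2 / ((x + y) / 2 + t) ^+ 2 <=
  (x ^+ 2 / (x + t) ^+ 2 + y ^+ 2 / (y + t) ^+ 2) / 2.
Proof.
move=> t0 x0 xt y0 yt; rewrite -subr_ge0.
set X := x + t; set Y := y + t.
have X0 : 0 < X by rewrite /X; lra.
have Y0 : 0 < Y by rewrite /Y; lra.
have -> : x = X - t by rewrite /X; ring.
have -> : y = Y - t by rewrite /Y; ring.
have -> : (X - t + (Y - t)) / 2 + t = (X + Y) / 2 by field.
have -> : ((X - t) ^+ 2 / X ^+ 2 + (Y - t) ^+ 2 / Y ^+ 2) / 2 -
    ((X - t + (Y - t)) / 2) ^+ 2 / ((X + Y) / 2) ^+ 2 =
  t * (X - Y) ^+ 2 * (t * (X ^+ 2 + 4 * X * Y + Y ^+ 2) - 2 * X * Y * (X + Y)) /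
    (2 * X ^+ 2 * Y ^+ 2 * (X + Y) ^+ 2).
  by field; rewrite !gt_eqF // addr_gt0.
apply: divr_ge0; last by rewrite ltW // !(mulr_gt0, exprn_gt0) // addr_gt0.
apply: mulr_ge0; first by rewrite mulr_ge0 ?sqr_ge0 ?ltW.
(* The bound t / 2 enters here: the last factor of the numerator is t (X - Y)^2 + 2 X Y (3 t - (X +
   Y)). *)
have XYt : X + Y <= 3 * t by rewrite /X /Y; lra.
have := ler_wpM2l (ltW (mulr_gt0 X0 Y0)) XYt.
have := mulr_ge0 (ltW t0) (sqr_ge0 (X - Y)); lra.
Qed.

Lemma sqr_ratio_lt (R : realType) (t x y : R) : 0 < t ->
  0 <= x -> x < y -> x ^+ 2 / (x + t) ^+ 2 < y ^+ 2 / (y + t) ^+ 2.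
Proof.
move=> t0 x0 xy; have y0 := le_lt_trans x0 xy.
have xt : 0 < x + t by lra.
have yt : 0 < y + t by lra.
rewrite -!expr_div_n ltr_sqr ?nnegrE ?divr_ge0 ?(ltW y0) ?(ltW xt) ?(ltW yt) //.
rewrite ltr_pdivrMr // mulrAC ltr_pdivlMr //.
have := xy; rewrite -(ltr_pM2l t0); lra.
Qed.

(* If y < x, comparing the first objective at x with its value at the midpoint
   of x and y shows that it is strictly smaller at x than at y; the change of
   weights only increases the advantage of x, so y is not optimal. *)
Lemma argmin_weights_le (R : realType) (D : set R) (phi psi : R -> R)
    (p q p' q' x y : R) :
  {in D &, forall u v, u < v -> phi u < phi v} ->
  {in D &, forall u v, u < v -> psi v < psi u} ->
  {in D &, forall u v, D ((u + v) / 2)} ->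
  {in D &, forall u v, phi ((u + v) / 2) <= (phi u + phi v) / 2} ->
  {in D &, forall u v, u != v -> psi ((u + v) / 2) < (psi u + psi v) / 2} ->
  0 <= q -> 0 <= p' -> p' <= p -> q <= q' -> (p != 0) || (q != 0) ->
  is_argmin D (fun a => p * phi a + q * psi a) x ->
  is_argmin D (fun a => p' * phi a + q' * psi a) y ->
  x <= y.
Proof.
move=> phi_mono psi_mono Dmid phi_cvx psi_cvx q0 p'0 p'p qq' pq.
move=> [Dx xmin] [Dy ymin].
have xD : x \in D by rewrite inE.
have yD : y \in D by rewrite inE.
rewrite leNgt; apply/negP => yx.
have u0 := phi_mono _ _ yD xD yx; have v0 := psi_mono _ _ yD xD yx.
have fxy := xmin _ Dy; have fyx := ymin _ Dx.
(* Strictness at the midpoint comes from [psi] and needs q > 0. For q = 0 the first objective is a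
   positive multiple of the increasing [phi]. *)
have [q_eq0|q_neq0] := eqVneq q 0.
  have p0 : 0 < p.
    rewrite lt_def (le_trans p'0 p'p) andbT.
    by move: pq; rewrite q_eq0 eqxx orbF.
  by move: fxy; rewrite q_eq0 !mul0r !addr0 ler_pM2l // leNgt u0.
have qpos : 0 < q by rewrite lt_def q_neq0.
have fxm := xmin _ (Dmid _ _ xD yD).
have phim := ler_wpM2l (le_trans p'0 p'p) (phi_cvx _ _ xD yD).
have psim : q * psi ((x + y) / 2) < q * ((psi x + psi y) / 2).
  by rewrite ltr_pM2l // psi_cvx // gt_eqF.
rewrite -subr_gt0 in u0; rewrite -subr_gt0 in v0.
have := ler_wpM2r (ltW v0) qq'; have := ler_wpM2r (ltW u0) p'p; lra.
Qed.

(** * Monotonicity of the I-PRO step and of the sequence *)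

Lemma ipro_step_le (R : realType) (n m : nat) (A : 'M[R]_(n, m))
    (s : (\rank A).-tuple R) (g : 'cV[R]_n) (a b a' b' : R) :
  A != 0 -> (forall i, 0 < tnth s i) -> g != 0 ->
  0 <= a -> a <= b ->
  is_argmin `[0, s`_0 ^+ 2 / 2]%classic (ipro_objective A g s a) a' ->
  is_argmin `[0, s`_0 ^+ 2 / 2]%classic (ipro_objective A g s b) b' ->
  a' <= b'.
Proof.
move=> A0 s0 g0 a0 ab.
have rA : (0 < \rank A)%N by rewrite lt0n mxrank_eq0.
have n0 : (0 < n)%N := leq_trans rA (rank_leq_row A).
have nV0 : 0 < n%:R^-1 :> R by rewrite invr_gt0 ltr0n.
have t0 : 0 < s`_0 ^+ 2.
  by have := s0 (Ordinal rA); rewrite (tnth_nth 0) /= => ?; rewrite exprn_gt0.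
(* Strict comparison of the sums over singular values requires a nonempty index set. *)
have ord_has : has xpredT (index_enum 'I_(\rank A)).
  by apply/hasP; exists (Ordinal rA); rewrite ?mem_index_enum.
have b0 := le_trans a0 ab.
have Tab := residual2_nondecreasing A g a0 ab.
have s20 i : 0 < tnth s i ^+ 2 by rewrite exprn_gt0.
have s40 i : 0 < tnth s i ^+ 4 by rewrite exprn_gt0.
rewrite /ipro_objective; apply: argmin_weights_le.
- move=> u v; rewrite !inE /= !in_itv /= => /andP[u0 _] _ uv.
  exact: sqr_ratio_lt.
- move=> u v; rewrite !inE /= !in_itv /= => /andP[u0 _] /andP[v0 _] uv.
  apply: ltr_sum => // i _; rewrite ltr_pM2l //.
  have si := s20 i.
  by rewrite ltf_pV2 ?posrE ?exprn_gt0 ?ltr_sqr ?nnegrE; lra.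
- move=> u v; rewrite !inE /= !in_itv /= => /andP[? ?] /andP[? ?].
  by apply/andP; split; lra.
- move=> u v; rewrite !inE /= !in_itv /= => /andP[? ?] /andP[? ?].
  exact: sqr_ratio_midpoint.
- move=> u v; rewrite !inE /= !in_itv /= => /andP[? ?] /andP[? ?] uv.
  rewrite -big_split mulr_suml; apply: ltr_sum => // i _ /=.
  have si := s20 i; rewrite -mulrDr -mulrA ltr_pM2l //.
  have -> : (u + v) / 2 + tnth s i ^+ 2 =
    (u + tnth s i ^+ 2 + (v + tnth s i ^+ 2)) / 2 by field.
  by apply: sqrV_midpoint; rewrite ?(inj_eq (addIr _)) //; lra.
- by rewrite mulr_ge0 ?residual2_ge0 ?ltW.
- by rewrite subr_ge0 residual2_le.
- by rewrite lerD2l lerN2.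
- by rewrite ler_pM2l.
(* If both weights vanished, the residual would be zero and then |g|^2 as well. *)
- rewrite /rho2 /sigma2 mulf_eq0 (gt_eqF nV0) /= -negb_and.
  apply: contra g0 => /andP[/eqP rho0 /eqP T0].
  move: rho0; rewrite T0 subr0 => g2.
  by apply/eqP/dotv_le0; rewrite -euclid_norm_sqr g2.
Qed.

Theorem theorem1 (R : realType) (n m : nat) (A : 'M[R]_(n, m))
    (s : (\rank A).-tuple R) (g : 'cV[R]_n) (alpha : nat -> R) :
  A != 0 ->
  positive_singular_values A s ->
  g != 0 ->
  ipro_sequence A g s alpha ->
  nondecreasing_seq alpha \/ nonincreasing_seq alpha.
Proof.
move=> A0 [_ s0 _] g0 [alpha0 step].
have alpha_ge0 k : 0 <= alpha k.
  case: k => [|k]; first by move: alpha0; rewrite in_itv => /andP[].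
  by have [+ _] := step k; rewrite /= in_itv => /andP[].
(* Either order of the first two terms propagates by induction through [ipro_step_le]. *)
have [le01|/ltW le10] := leP (alpha 0%N) (alpha 1%N); [left|right].
- apply/nondecreasing_seqP; elim=> // k le_k.
  exact: (ipro_step_le A0 s0 g0 (alpha_ge0 k) le_k (step k) (step k.+1)).
- apply/nonincreasing_seqP; elim=> // k le_k.
  exact: (ipro_step_le A0 s0 g0 (alpha_ge0 k.+1) le_k (step k.+1) (step k)).
Qed.
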